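(* Let $(\bar{M}, g)$ be a compact Riemannian manifold with smooth boundary $\partial M$ and interior $M$, with $n = \dim \bar{M} \geqslant 3$. Suppose that the scalar curvature satisfies $S_{g} \geqslant 0$ everywhere. Then there exists a metric $\tilde{g}$ conformal to $g$, with scalar curvature $\tilde{S}$ and mean curvature $\tilde{h}$ on $\partial M$, such that $\tilde{S} < 0$ somewhere, and $\operatorname{sgn}(h_{g}) = \operatorname{sgn}(\tilde{h})$ pointwise on $\partial M$.
   Context: A metric conformal to $g$ is a metric of the form $\tilde{g} = u^{p-2} g$ with $p = \frac{2n}{n-2}$ and $u \in C^{\infty}(\bar{M})$, $u > 0$ on $\bar{M}$. $S_{g}$ is the scalar curvature of $g$ and $h_{g}$ the mean curvature of $\partial M$ with respect to $g$, taken with respect to the outward unit normal $\nu$, with sign and normalization such that under $\tilde{g} = e^{2f} g$ it transforms as $\tilde{h} = e^{-f}\left(h_{g} + \frac{\partial f}{\partial \nu}\right)$ (the average of the principal curvatures, positive for the Euclidean ball). $\operatorname{sgn}$ takes values in $\{-1, 0, 1\}$. *)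

(* Defs.v *)
From HB Require Import structures.
From mathcomp Require Import all_boot all_order all_algebra.
From mathcomp Require Import all_classical all_reals all_analysis.
Set Implicit Arguments.
Unset Strict Implicit.
Unset Printing Implicit Defensive.
Import Order.TTheory GRing.Theory Num.Theory.
Import numFieldNormedType.Exports.
Local Open Scope classical_set_scope.
Local Open Scope ring_scope.

(* Throughout, the dimension is n.+1.  Local models are relatively open subsets
   of the closed half-space x_0 >= 0, so that along the boundary the tangential
   coordinates are x_1, ..., x_n, i.e. those with index [lift ord0 a]. *)

Section Calculus.
Variables (R : realType) (n : nat).
Local Notation E := 'rV[R]_n.+1.

Definition halfspace : set E := [set x | 0 <= x ord0 ord0].

Definition basis_vec (i : 'I_n.+1) : E := delta_mx ord0 i.

(* The i-th partial derivative computed inside the half-space: it is the usual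
   partial derivative where x_0 > 0, and the derivative along x_0 is one-sided
   where x_0 = 0.  (Library derivatives would inspect the junk values outside
   the half-space.) *)
Definition pderiv (i : 'I_n.+1) (f : E -> R) (x : E) : R :=
  lim ((fun t : R => t^-1 * (f (x + t *: basis_vec i) - f x))
         @ within [set t | halfspace (x + t *: basis_vec i)] 0^').

(* f is of class C^k on the open set V *)
Fixpoint Ck (k : nat) (V : set E) (f : E -> R) : Prop :=
  match k with
  | 0%N => forall x, V x -> {for x, continuous f}
  | k'.+1 => (forall x, V x -> differentiable f x) /\
             (forall v : E, Ck k' V (fun x => 'D_v f x))
  end.

(* A function on an arbitrary subset of R^(n+1) is smooth if it locally extends
   to a C^oo function on an open set. *)
Definition smooth_on (A : set E) (f : E -> R) : Prop :=
  forall x, A x -> exists (V : set E) (F : E -> R),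
    [/\ open V, V x, (forall k, Ck k V F) &
        forall y, V y -> A y -> F y = f y].

End Calculus.

(* Smooth manifolds with (possibly empty) boundary, of dimension n.+1.  The
   inverse chart [cinv i] is only meaningful on the image of the chart i.
   [chart_at p] is a chosen chart around p, in which pointwise invariants at p
   (being a boundary point, the curvatures) are evaluated; their values do not
   depend on this choice. *)
Record bmanifold (R : realType) (n : nat) := BManifold {
  carrier :> topologicalType;
  bm_hausdorff : hausdorff_space carrier;
  bm_second_countable : @second_countable carrier;
  chart_idx : Type;
  cdom : chart_idx -> set carrier;
  cmap : chart_idx -> carrier -> 'rV[R]_n.+1;
  cinv : chart_idx -> 'rV[R]_n.+1 -> carrier;
  chart_at : carrier -> chart_idx;
  chart_atP : forall p, cdom (chart_at p) p;
  cdom_open : forall i, open (cdom i);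
  cmap_open : forall i, exists V : set 'rV[R]_n.+1,
    open V /\ cmap i @` cdom i = V `&` @halfspace R n;
  cmapK : forall i p, cdom i p -> cinv i (cmap i p) = p;
  cmap_continuous : forall i, {within cdom i, continuous (cmap i)};
  cinv_continuous : forall i,
    {within cmap i @` cdom i, continuous (cinv i)};
  transition_smooth : forall i j (k : 'I_n.+1),
    smooth_on (cmap i @` (cdom i `&` cdom j))
              (fun x => cmap j (cinv i x) ord0 k) }.

Section Manifold.
Variables (R : realType) (n : nat) (M : bmanifold R n).
Local Notation E := 'rV[R]_n.+1.
Local Notation idx := (chart_idx M).

Definition cimg (i : idx) : set E := cmap i @` cdom i.

Definition bm_boundary : set M :=
  [set p | cmap (chart_at p) p ord0 ord0 = 0].

Definition smooth_fun (u : M -> R) : Prop :=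
  forall i : idx, smooth_on (cimg i) (u \o cinv i).

(* Row a contains the a-th partial derivatives of the transition map from the
   chart i to the chart j. *)
Definition transition_jac (i j : idx) (x : E) : 'M[R]_n.+1 :=
  \matrix_(a, c) pderiv a (fun y => cmap j (cinv i y) ord0 c) x.

(* A Riemannian metric is given by its component matrices in all the charts. *)
Record riemannian_metric := RiemannianMetric {
  gmx : idx -> E -> 'M[R]_n.+1;
  gmx_smooth : forall i a b, smooth_on (cimg i) (fun x => gmx i x a b);
  gmx_sym : forall i x, cimg i x -> (gmx i x)^T = gmx i x;
  gmx_pos : forall i x (v : E), cimg i x -> v != 0 ->
    0 < (v *m gmx i x *m v^T) ord0 ord0;
  gmx_compat : forall i j x, (cmap i @` (cdom i `&` cdom j)) x ->
    gmx i x = transition_jac i j x *m gmx j (cmap j (cinv i x))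
                *m (transition_jac i j x)^T }.

End Manifold.

(* Coordinate expressions; G is the matrix of components of a metric in a chart. *)
Section LocalGeometry.
Variables (R : realType) (n : nat).
Local Notation E := 'rV[R]_n.+1.
Variable G : E -> 'M[R]_n.+1.

Definition christoffel (k i j : 'I_n.+1) (x : E) : R :=
  2^-1 * \sum_l invmx (G x) k l *
    (pderiv i (fun y => G y j l) x + pderiv j (fun y => G y i l) x
     - pderiv l (fun y => G y i j) x).

(* R(d_i, d_j) d_k = \sum_l (riemann l k i j) d_l, where
   R(X, Y) = [nabla_X, nabla_Y] - nabla_[X, Y]. *)
Definition riemann (l k i j : 'I_n.+1) (x : E) : R :=
  pderiv i (christoffel l j k) x - pderiv j (christoffel l i k) x
  + \sum_m (christoffel l i m x * christoffel m j k x
            - christoffel l j m x * christoffel m i k x).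

Definition ricci (j k : 'I_n.+1) (x : E) : R := \sum_i riemann i k i j x.

Definition scalar_curv (x : E) : R :=
  \sum_j \sum_k invmx (G x) j k * ricci j k x.

(* Components of - grad x_0 / |grad x_0|, which on the boundary x_0 = 0 is the
   outward unit normal. *)
Definition unit_normal (k : 'I_n.+1) (x : E) : R :=
  - (invmx (G x) k ord0 / Num.sqrt (invmx (G x) ord0 ord0)).

(* k-th component of the covariant derivative of the normal along d_i *)
Definition nabla_normal (k i : 'I_n.+1) (x : E) : R :=
  pderiv i (unit_normal k) x + \sum_l christoffel k i l x * unit_normal l x.

(* II(d_a, d_b) = g(nabla_{d_a} nu, d_b), for the tangential coordinates *)
Definition second_ff (x : E) : 'M[R]_n :=
  \matrix_(a, b) \sum_k nabla_normal k (lift ord0 a) x * G x k (lift ord0 b).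

Definition induced_metric (x : E) : 'M[R]_n := row' ord0 (col' ord0 (G x)).

(* Average of the principal curvatures, the eigenvalues of the second
   fundamental form with respect to the induced metric. *)
Definition mean_curv (x : E) : R :=
  n%:R^-1 * \tr (invmx (induced_metric x) *m second_ff x).

End LocalGeometry.

Section Geometry.
Variables (R : realType) (n : nat) (M : bmanifold R n).

Definition scalar_curvature (g : riemannian_metric M) (p : M) : R :=
  scalar_curv (gmx g (chart_at p)) (cmap (chart_at p) p).

(* Only meaningful for p on the boundary *)
Definition mean_curvature (g : riemannian_metric M) (p : M) : R :=
  mean_curv (gmx g (chart_at p)) (cmap (chart_at p) p).

(* p = 2d / (d - 2), where d = n.+1 is the dimension *)
Definition crit_exp : R := 2 * n.+1%:R / (n.+1%:R - 2).

Definition conformal (g g' : riemannian_metric M) : Prop :=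
  exists u : M -> R,
    [/\ smooth_fun u, (forall p, 0 < u p) &
        forall i x, cimg i x ->
          gmx g' i x = (u (cinv i x) `^ (crit_exp - 2)) *: gmx g i x].

End Geometry.

(* Main.v *)
(* Let [p] be an interior point.  In a chart around [p] choose a smooth [h],
   supported in a small coordinate ball contained in the interior, with
   [h = 0], [dh = 0] and [Hess h = kappa I] at [p].  For [g' = e^(2h) g] the
   Christoffel symbols at [p] do not change, and only their first derivatives
   see [Hess h], so that
     S'(p) = S(p) - 2 (dim - 1) kappa tr (g^-1)(p),
   which is negative for [kappa] large.  Since [h] vanishes near the boundary,
   the mean curvature does not change at all.  The function [h] is
   [c |y - p|^2 theta(r - |y - p|^2)] with [theta(t) = exp(-1/t)] for [t > 0] and
   [0] otherwise. *)
From HB Require Import structures.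
Require Import Defs.
From mathcomp Require Import all_boot all_order all_algebra.
From mathcomp Require Import all_classical all_reals all_analysis.
From mathcomp Require Import ring lra.
Set Implicit Arguments.
Unset Strict Implicit.
Unset Printing Implicit Defensive.
Import Order.TTheory GRing.Theory Num.Theory.
Import numFieldNormedType.Exports.
Local Open Scope classical_set_scope.
Local Open Scope ring_scope.

(** * Calculus of [Ck] functions on open sets *)

Lemma near_eq_differentiable (R : numFieldType) (V W : normedModType R)
    (f g : V -> W) (x : V) :
  (\near x, f x = g x) -> differentiable f x -> differentiable g x.
Proof.
move=> fg df.
have [cd e] := (diff_locallyP _ _).1 df.
(* The remainders of [f] and [g] coincide near [0], so the first-order expansion of [f] is also one
   of [g]. *)
have gE : g \o shift x = cst (g x) + 'd f x +o_ (0 : V) id.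
  apply/eqaddoP => _/posnumP[eps].
  have /eqaddoP/(_ eps%:num (gt0 _)) fe := e.
  near=> h.
  have -> : ((g \o shift x) - (cst (g x) + 'd f x)) h =
         ((f \o shift x) - (cst (f x) + 'd f x)) h.
    rewrite !fctE /= (nbhs_singleton fg).
    have -> // : f (h + x) = g (h + x).
    near: h.
    move: fg; rewrite (near_shift 0 x) /= => fg.
    by apply: filterS fg => h /=; rewrite subr0.
  near: h; exact: fe.
apply/diff_locallyP.
by rewrite (diff_unique cd gE); split.
Unshelve. all: by end_near. Qed.

Section CkTheory.
Variables (R : realType) (n : nat).
Local Notation E := 'rV[R]_n.+1.
Implicit Types (V : set E) (f g : E -> R).

Lemma Ck_differentiable k V f x : Ck k.+1 V f -> V x -> differentiable f x.
Proof. by case=> h _; exact: h. Qed.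

Lemma Ck_derivable k V f x v : Ck k.+1 V f -> V x -> derivable f x v.
Proof. by move=> h Vx; apply: diff_derivable; apply: Ck_differentiable h Vx. Qed.

(** The sum, product and chain rules give derivatives on [V] only, so [Ck] has to ignore values off
    [V]. Since [V] is open, agreement on [V] is agreement near each of its points, which derivatives
    respect; this passes through the induction on [k]. *)
Lemma Ck_eq k V f g : open V -> (forall x, V x -> f x = g x) ->
  Ck k V f -> Ck k V g.
Proof.
move=> oV.
have near_fg f1 g1 x : (forall x, V x -> f1 x = g1 x) -> V x ->
    \near x, f1 x = g1 x.
  by move=> fg Vx; near=> y; apply: fg; near: y; exact: open_nbhs_nbhs.
elim: k f g => [|k IH] f g fg.
  move=> cf x Vx; suff : g y @[y --> x] --> g x by [].
  rewrite -(fg _ Vx).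
  exact: cvg_trans (near_eq_cvg (near_fg _ _ _ fg Vx)) (cf x Vx).
move=> [df Df]; split=> [x Vx|v].
  exact: near_eq_differentiable (near_fg _ _ _ fg Vx) (df _ Vx).
apply: IH (Df v) => x Vx.
exact: near_eq_derive (near_fg _ _ _ fg Vx).
Unshelve. all: by end_near. Qed.

Lemma Ck_sub k V V' f : V' `<=` V -> Ck k V f -> Ck k V' f.
Proof.
move=> VV; elim: k f => [|k IH] f /=; first by move=> h x /VV; exact: h.
by move=> [df Df]; split=> [x /VV|v]; [exact: df|apply: IH].
Qed.

Lemma Ck_pred k V f : Ck k.+1 V f -> Ck k V f.
Proof.
elim: k f => [|k IH] f [df Df].
  by move=> x Vx; apply: differentiable_continuous; apply: df.
by split=> // v; apply: IH.
Qed.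

Lemma Ck_cst k V (c : R) : Ck k V (cst c).
Proof.
elim: k c => [|k IH] c /=; first by move=> x _; exact: cst_continuous.
split=> [x _|v]; first exact: differentiable_cst.
have -> : (fun x => 'D_v (cst c) x) = cst 0 by apply/funext => x; rewrite derive_cst.
exact: IH.
Qed.

Lemma Ck_add k V f g : open V -> Ck k V f -> Ck k V g ->
  Ck k V (fun x => f x + g x).
Proof.
move=> oV; elim: k f g => [|k IH] f g /=.
  by move=> cf cg x Vx; apply: continuousD; [exact: cf|exact: cg].
move=> [df Df] [dg Dg]; split=> [x Vx|v].
  by apply: differentiableD; [exact: df|exact: dg].
apply: (Ck_eq oV _ (IH _ _ (Df v) (Dg v))) => x Vx.
by rewrite -deriveD //; apply: diff_derivable; [exact: df|exact: dg].
Qed.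

Lemma Ck_mul k V f g : open V -> Ck k V f -> Ck k V g ->
  Ck k V (fun x => f x * g x).
Proof.
move=> oV; elim: k f g => [|k IH] f g.
  by move=> cf cg x Vx; apply: continuousM; [exact: cf|exact: cg].
move=> Cf Cg; have [df Df] := Cf; have [dg Dg] := Cg; split=> [x Vx|v].
  by apply: differentiableM; [exact: df|exact: dg].
apply: (Ck_eq oV _ (Ck_add oV (IH _ _ (Ck_pred Cf) (Dg v))
  (IH _ _ (Ck_pred Cg) (Df v)))) => x Vx.
by rewrite -deriveM //; apply: diff_derivable; [exact: df|exact: dg].
Qed.

Lemma Ck_sum k V (I : Type) (s : seq I) (P : pred I) (F : I -> E -> R) :
  open V -> (forall i, Ck k V (F i)) ->
  Ck k V (fun x => \sum_(i <- s | P i) F i x).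
Proof.
move=> oV CF; elim: s => [|i s IH].
  by apply: (Ck_eq oV _ (@Ck_cst k V 0)) => x _; rewrite big_nil.
case Pi : (P i).
  by apply: (Ck_eq oV _ (Ck_add oV (CF i) IH)) => x _; rewrite big_cons Pi.
by apply: (Ck_eq oV _ IH) => x _; rewrite big_cons Pi.
Qed.

Lemma Ck_prod k V (I : Type) (s : seq I) (P : pred I) (F : I -> E -> R) :
  open V -> (forall i, Ck k V (F i)) ->
  Ck k V (fun x => \prod_(i <- s | P i) F i x).
Proof.
move=> oV CF; elim: s => [|i s IH].
  by apply: (Ck_eq oV _ (@Ck_cst k V 1)) => x _; rewrite big_nil.
case Pi : (P i).
  by apply: (Ck_eq oV _ (Ck_mul oV (CF i) IH)) => x _; rewrite big_cons Pi.
by apply: (Ck_eq oV _ IH) => x _; rewrite big_cons Pi.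
Qed.

Lemma derive_comp_real (th : R -> R) (dth : R) f x v :
  is_derive (f x) 1 th dth -> differentiable f x ->
  differentiable (fun y => th (f y)) x /\
  'D_v (fun y => th (f y)) x = dth * 'D_v f x.
Proof.
move=> dt df.
have dth' : differentiable th (f x) by apply/derivable1_diffP; case: dt.
have dc : differentiable (th \o f) x by exact: differentiable_comp.
split=> //.
rewrite (deriveE v dc) (deriveE v df) diff_comp //=.
have [dt1 dt2] := dt.
by rewrite deriv1E // derive1E dt2 mulrC.
Qed.

(* [S] is a class of real functions stable under derivation on [D], which makes
   the induction on [k] go through without formulas for iterated derivatives. *)
Lemma Ck_comp k (S : (R -> R) -> Prop) (D : set R) V th f : open V ->
  (forall t, S t -> exists2 t', S t' & forall s, D s -> is_derive s 1 t (t' s)) ->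
  S th -> (forall x, V x -> D (f x)) -> Ck k V f ->
  Ck k V (fun x => th (f x)).
Proof.
move=> oV Sd; elim: k th f => [|k IH] th f Sth fD Cf; have [t' St' dt] := Sd _ Sth.
  move=> x Vx; apply: continuous_comp; first exact: Cf.
  apply: differentiable_continuous; apply/derivable1_diffP.
  by case: (dt _ (fD _ Vx)).
have [df Df] := Cf; split=> [x Vx|v].
  exact: (derive_comp_real 0 (dt _ (fD _ Vx)) (df _ Vx)).1.
apply: (Ck_eq oV _ (Ck_mul oV (IH _ _ St' fD (Ck_pred Cf)) (Df v))) => x Vx.
by rewrite (derive_comp_real v (dt _ (fD _ Vx)) (df _ Vx)).2.
Qed.

Lemma Ck_expR k V f : open V -> Ck k V f -> Ck k V (fun x => expR (f x)).
Proof.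
move=> oV; apply: (@Ck_comp k [set expR] setT) => // t ->.
by exists expR => // s _; exact: is_derive_expR.
Qed.

(** Induction on [k]: the derivative [- f' * f^-1 * f^-1] contains only inverses that are already of
    class [Ck k]. *)
Lemma Ck_inv k V f : open V -> (forall x, V x -> f x != 0) -> Ck k V f ->
  Ck k V (fun x => (f x)^-1).
Proof.
move=> oV f0; elim: k => [|k IH] Cf.
  by move=> x Vx; apply: continuousV; [exact: f0|exact: Cf].
have [df Df] := Cf; split=> [x Vx|v].
  by apply: differentiableV; [exact: df|exact: f0].
have CI := IH (Ck_pred Cf).
apply: (Ck_eq oV _ (Ck_mul oV (Ck_mul oV (@Ck_cst k V (-1)) (Df v))
  (Ck_mul oV CI CI))) => x Vx.
rewrite deriveV; [|exact: f0|by apply: diff_derivable; exact: df].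
rewrite /= /GRing.scale /=; rewrite -exprVn; ring.
Qed.

(** A coordinate is a continuous linear form, hence its own differential. *)
Lemma derive_coord (c : 'I_n.+1) (x v : E) :
  'D_v (fun y : E => y ord0 c) x = v ord0 c.
Proof.
pose f : E -> R := fun y => y ord0 c.
have lf : linear f by move=> a y z; rewrite /f !mxE.
pose fM := GRing.isLinear.Build _ _ _ _ f lf.
pose fL : {linear E -> R} := HB.pack f fM.
rewrite (deriveE v (differentiable_coord x ord0 c)).
by rewrite -/f -[f]/(fL : E -> R) diff_lin //; exact: coord_continuous.
Qed.

Lemma Ck_coord k V (c : 'I_n.+1) : open V -> Ck k V (fun x => x ord0 c).
Proof.
move=> oV.
case: k => [|k].
  by move=> x _; apply: differentiable_continuous; exact: differentiable_coord.
split=> [x _|v]; first exact: differentiable_coord.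
by apply: (Ck_eq oV _ (@Ck_cst k V (v ord0 c))) => x _; rewrite derive_coord.
Qed.

End CkTheory.

(** * The flat function exp(-1/t) and its derivatives *)

Section FlatFunction.
Variable R : realType.
Implicit Types (p : {poly R}) (t s : R).

(** [flat 1] is the classical smooth function exp(-1/t), extended by zero. The factor [p] in [t^-1]
    makes the family stable under derivation. *)
Definition flat p t : R := if 0 < t then p.[t^-1] * expR (- t^-1) else 0.

(** By the exponential series s^k / k! is at most e^s for s > 0; the bounds of the monomials are
    added up with the coefficients of [p]. *)
Lemma horner_le_expR p :
  exists2 C : R, 0 <= C & forall s, 0 < s -> `|p.[s]| <= C * expR s.
Proof.
exists (\sum_(i < size p) `|p`_i| * i`!%:R).
  by apply: sumr_ge0 => i _; rewrite mulr_ge0.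
move=> s s0; rewrite horner_coef (le_trans (ler_norm_sum _ _ _))// mulr_suml.
apply: ler_sum => i _; rewrite normrM -mulrA ler_wpM2l//.
rewrite ger0_norm ?exprn_ge0 ?(ltW s0)//.
case: (nat_of_ord i) => [|k].
  by rewrite expr0 mul1r (le_trans _ (expR_ge1Dx _))// lerDl ltW.
rewrite mulrC -ler_pdivrMr ?ltr0n ?fact_gt0//.
by rewrite (le_trans _ (expR_ge1Dxn k (ltW s0)))// lerDr.
Qed.

Lemma is_derive_flat0 p : is_derive (0 : R) 1 (flat p) 0.
Proof.
(* With s = 1/h the difference quotient for h > 0 equals h * (s^2 p(s)) e^(-s), so the bound for
   ['X^2 * p] makes it at most C h. *)
have [C C0 hC] := horner_le_expR ('X^2 * p).
suff H : (fun h : R => h^-1 *: ((flat p \o shift 0) (h *: (1 : R)) - flat p 0))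
    @ 0^' --> (0 : R).
  by apply: DeriveDef; [apply/cvg_ex; exists 0|exact/cvg_lim].
have f0 : flat p 0 = 0 by rewrite /flat ltxx.
apply/cvgr0Pnorm_le => e e0; near=> h.
rewrite f0 subr0 /= addr0 /GRing.scale /= mulr1.
have h0 : h != 0 by near: h; exact: nbhs_dnbhs_neq.
(* [C + 1] rather than [C], which may vanish. *)
have hlt : `|h| <= e / (C + 1).
  near: h; apply: dnbhs0_le; apply: divr_gt0 => //; lra.
rewrite /flat; case: ltP => [hp|_]; last by rewrite mulr0 normr0 ltW.
rewrite ger0_norm ?(ltW hp)// ler_pdivlMr in hlt; last lra.
have hi : 0 < h^-1 by rewrite invr_gt0.
have := hC _ hi; rewrite hornerM hornerXn normrM => hb.
rewrite !normrM (ger0_norm (ltW (expR_gt0 _))) (ger0_norm (ltW hi)).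
rewrite (ger0_norm (exprn_ge0 _ (ltW hi))) in hb.
rewrite expRN mulrA ler_pdivrMr ?expR_gt0//.
have -> : h^-1 * `|p.[h^-1]| = h * (h^-1 ^+ 2 * `|p.[h^-1]|) by field.
apply: le_trans (ler_wpM2l (ltW hp) hb) _.
rewrite mulrA ler_wpM2r ?(ltW (expR_gt0 _))//; nra.
Unshelve. all: by end_near. Qed.

(** For t > 0 and s = 1/t the product rule gives s^2 (p(s) - p'(s)) e^(-s), again a member of the
    family; for t < 0 the function is locally zero. *)
Lemma is_derive_flat p t :
  is_derive t 1 (flat p) (flat ('X^2 * (p - p^`())) t).
Proof.
have [t0|t0|->] := ltgtP t 0; last first.
- rewrite [X in is_derive _ _ _ X](_ : _ = 0); last by rewrite /flat ltxx.
  exact: is_derive_flat0.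
- apply: (@near_eq_is_derive _ _ _ (fun t => p.[t^-1] * expR (- t^-1))).
    near=> s; rewrite /flat ifT//; near: s; exact: lt_nbhsr.
  have tn0 : t != 0 by rewrite gt_eqF.
  rewrite /flat t0 hornerM hornerXn hornerD hornerN.
  have dV := is_deriveV tn0 (is_derive_id t (1 : R)).
  have dp := is_derive1_comp (is_derive_poly p t^-1) dV.
  have dN : is_derive t (1 : R) (fun s => - s^-1) _ := is_deriveN dV.
  have de := @is_derive1_comp R expR (fun s => - s^-1) t _ _
    (is_derive_expR (- t^-1)) dN.
  apply: (is_derive_eq (is_deriveM dp de)); rewrite /GRing.scale /=.
  by rewrite -exprVn; ring.
- apply: (@near_eq_is_derive _ _ _ (cst 0)).
    near=> s; rewrite /flat ltNge ifN// negbK ltW//; near: s; exact: lt_nbhsl.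
  rewrite [X in is_derive _ _ _ X](_ : _ = 0); first exact: is_derive_cst.
  by rewrite /flat ltNge (ltW t0).
Unshelve. all: by end_near. Qed.

Lemma Ck_flat n k (V : set 'rV[R]_n.+1) p f : open V -> Ck k V f ->
  Ck k V (fun x => flat p (f x)).
Proof.
move=> oV; apply: (@Ck_comp R n k [set f | exists q, f = flat q] setT) => //.
  move=> _ [q ->]; exists (flat ('X^2 * (q - q^`()))); first by eexists.
  by move=> s _; exact: is_derive_flat.
by exists p.
Qed.

End FlatFunction.

(** * Partial derivatives in the half-space, and smoothness of the inverse matrix *)

Section PartialDerivatives.
Variables (R : realType) (n : nat).
Local Notation E := 'rV[R]_n.+1.
Implicit Types (V : set E) (f g : E -> R).

Lemma coord_basis_vec (i : 'I_n.+1) (x : E) (t : R) (c : 'I_n.+1) :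
  (x + t *: basis_vec R i) ord0 c = x ord0 c + t * (c == i)%:R.
Proof. by rewrite !mxE eqxx. Qed.

(** Off the boundary all small displacements stay in the half-space, so the restricted filter in
    [pderiv] is the full punctured neighbourhood. *)
Lemma pderiv_interior (i : 'I_n.+1) f (x : E) : 0 < x ord0 ord0 ->
  pderiv i f x = 'D_(basis_vec R i) f x.
Proof.
move=> x0; rewrite /pderiv /derive.
have H : \forall t \near (0 : R)^', halfspace (x + t *: basis_vec R i).
  apply: nbhs_dnbhs; near=> t; rewrite /halfspace /= coord_basis_vec.
  have : `|t| <= x ord0 ord0 by near: t; exact: (@nbhs0_le _ R).
  rewrite ler_norml => /andP[h _].
  by case: (ord0 == i) => /=; lra.
have -> : within [set t | halfspace (x + t *: basis_vec R i)] (0 : R)^' = (0 : R)^'.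
  apply/seteqP; split=> P hP; first exact: filter_app hP H.
  exact: (@cvg_within _ (0 : R)^' _ _ P hP).
suff -> : (fun t : R => t^-1 * (f (x + t *: basis_vec R i) - f x)) =
  (fun h : R => h^-1 *: ((f \o shift x) (h *: basis_vec R i) - f x)) by [].
by apply/funext => t /=; rewrite [x + _]addrC.
Unshelve. all: by end_near. Qed.

(** The limit in [pderiv] only samples points of the half-space, so agreement there is enough, also
    at a boundary point. *)
Lemma pderiv_near i f g (x : E) : halfspace x ->
  (\forall y \near x, halfspace y -> f y = g y) -> pderiv i f x = pderiv i g x.
Proof.
move=> hx fg; rewrite /pderiv.
have fgx : f x = g x by exact: nbhs_singleton fg hx.
have cx : (x + t *: basis_vec R i) @[t --> (0 : R)] --> x.
  rewrite -[X in _ --> X]addr0 -(scale0r (basis_vec R i)).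
  by apply: cvgD; [exact: cvg_cst|apply: cvgZr_tmp; exact: cvg_id].
set F := within _ _.
have H : \forall t \near F, t^-1 * (f (x + t *: basis_vec R i) - f x) =
    t^-1 * (g (x + t *: basis_vec R i) - g x).
  have Hd := nbhs_dnbhs (cx _ fg).
  rewrite /F near_withinE; apply: filterS Hd => t /= Ht ht.
  by rewrite fgx Ht.
congr (lim _); apply/seteqP; split; apply: near_eq_cvg => //.
by apply: filterS H => t ->.
Qed.

Lemma Ck_derive k V f v : Ck k.+1 V f -> Ck k V (fun x => 'D_v f x).
Proof. by case=> _; exact. Qed.

Lemma Ck_det k V m (A : E -> 'M[R]_m) : open V ->
  (forall i j, Ck k V (fun x => A x i j)) -> Ck k V (fun x => \det (A x)).
Proof.
move=> oV CA; rewrite /determinant; apply: Ck_sum => // s.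
by apply: Ck_mul => //; [exact: Ck_cst|apply: Ck_prod].
Qed.

Lemma Ck_invmx k V m (A : E -> 'M[R]_m) i j : open V ->
  (forall i j, Ck k V (fun x => A x i j)) ->
  (forall x, V x -> A x \in unitmx) -> Ck k V (fun x => invmx (A x) i j).
Proof.
move=> oV CA uA.
(* Cramer's formula: cofactors over the determinant. *)
apply: (@Ck_eq _ _ k V (fun x => (\det (A x))^-1 *
    ((-1) ^+ (j + i) * \det (row' j (col' i (A x)))))) => //.
  by move=> x Vx; rewrite /invmx uA// !mxE.
apply: Ck_mul => //.
  apply: Ck_inv => //; last exact: Ck_det.
  by move=> x /uA; rewrite unitmxE unitfE.
apply: Ck_mul => //; first exact: Ck_cst.
apply: Ck_det => // a b.
by apply: Ck_eq (CA (lift j a) (lift i b)) => // x _; rewrite !mxE.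
Qed.

End PartialDerivatives.

(** * Curvature of [e^(2h) G] at a critical zero of [h] *)

Section ConformalChange.
Variables (R : realType) (n : nat) (V : set 'rV[R]_n.+1).
Local Notation E := 'rV[R]_n.+1.
Local Notation e := (@basis_vec R n).
Hypotheses (oV : open V) (V_gt0 : forall x : E, V x -> 0 < x ord0 ord0).

Lemma pderivE i (f : E -> R) x : V x -> pderiv i f x = 'D_(e i) f x.
Proof. by move=> Vx; apply: pderiv_interior; exact: V_gt0. Qed.

Lemma Ck_pderiv k i (f : E -> R) : Ck k.+1 V f -> Ck k V (pderiv i f).
Proof.
move=> /(Ck_derive (e i)); apply: Ck_eq => // x Vx.
by rewrite pderivE.
Qed.

Lemma Ck_christoffel (G : E -> 'M[R]_n.+1) p k i j :
  (forall a b, Ck p.+1 V (fun x => G x a b)) ->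
  (forall x, V x -> G x \in unitmx) -> Ck p V (christoffel G k i j).
Proof.
move=> CG uG; rewrite /christoffel; apply: Ck_mul => //; first exact: Ck_cst.
apply: Ck_sum => // l; apply: Ck_mul => //.
  by apply: Ck_invmx => // a b; apply: Ck_pred.
apply: Ck_add => //; first by apply: Ck_add => //; apply: Ck_pderiv.
apply: (Ck_eq oV _ (Ck_mul oV (@Ck_cst R n p V (-1)) (Ck_pderiv l (CG i j)))).
by move=> x _; rewrite mulN1r.
Qed.

Variables (G : E -> 'M[R]_n.+1) (h : E -> R).
Hypotheses (CG : forall k i j, Ck k V (fun x => G x i j))
  (G_sym : forall x, V x -> (G x)^T = G x)
  (G_unit : forall x, V x -> G x \in unitmx)
  (Ch : forall k, Ck k V h).

Let w (x : E) : R := expR (2 * h x).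
Let wG (x : E) : 'M[R]_n.+1 := w x *: G x.

Lemma expR2_neq0 x : w x != 0. Proof. by rewrite gt_eqF// expR_gt0. Qed.

Lemma Ck_expR2 k : Ck k V w.
Proof. by apply: Ck_expR => //; apply: Ck_mul => //; exact: Ck_cst. Qed.

Lemma pderiv_conformal i a b x : V x -> pderiv i (fun y => wG y a b) x =
  w x * (pderiv i (fun y => G y a b) x + 2 * G x a b * pderiv i h x).
Proof.
move=> Vx; rewrite !pderivE//.
have dh : differentiable h x := Ck_differentiable (Ch 1) Vx.
have dw : 'D_(e i) w x = 2 * w x * 'D_(e i) h x.
  rewrite (derive_comp_real (e i) (is_derive_expR (2 * h x)) _).2; last first.
    by apply: differentiableM => //; exact: differentiable_cst.
  rewrite deriveM; [|exact: derivable_cst|exact: diff_derivable].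
  by rewrite derive_cst /GRing.scale /=; rewrite /w; ring.
rewrite (_ : (fun y => wG y a b) = (fun y => w y * G y a b)); last first.
  by apply/funext => y; rewrite !mxE.
rewrite deriveM; first last.
- exact: Ck_derivable (CG 1 a b) Vx.
- exact: Ck_derivable (Ck_expR2 1) Vx.
by rewrite dw /GRing.scale /=; ring.
Qed.

Lemma sum_invmx_mul x k j : V x -> \sum_l invmx (G x) k l * G x j l = (k == j)%:R.
Proof.
move=> Vx; transitivity ((invmx (G x) *m G x) k j).
  by rewrite mxE; apply: eq_bigr => l _; rewrite -{2}(G_sym Vx) mxE.
by rewrite mulVmx ?G_unit// mxE.
Qed.

(* Change of the Christoffel symbols from [G] to [e^(2h) G]. *)
Definition christoffel_diff (k i j : 'I_n.+1) (x : E) : R :=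
  (k == j)%:R * 'D_(e i) h x + (k == i)%:R * 'D_(e j) h x
  - \sum_l invmx (G x) k l * G x i j * 'D_(e l) h x.

Lemma christoffel_conformal k i j x : V x ->
  christoffel wG k i j x = christoffel G k i j x + christoffel_diff k i j x.
Proof.
move=> Vx; rewrite /christoffel /christoffel_diff.
(* The Kronecker symbols are expanded back into contractions of [invmx (G x)] with [G x]; both sides
   are then sums over [l] that agree term by term, the factor [w x] cancelling against its
   inverse. *)
rewrite -(sum_invmx_mul k j Vx) -(sum_invmx_mul k i Vx) !mulr_suml !mulr_sumr.
rewrite -sumrN -!big_split /=; apply: eq_bigr => l _.
have -> : invmx (wG x) k l = (w x)^-1 * invmx (G x) k l.
  by rewrite /wG invmxZ ?mxE// unitmxZ ?G_unit// unitfE expR2_neq0.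
rewrite !pderiv_conformal// !(@pderivE _ h)//.
have := expR2_neq0 x; have : 2 != 0 :> R by []; move: (w x) => c c0 c1.
by field.
Qed.

Variables (x0 : E) (kappa : R).
Hypotheses (Vx0 : V x0) (h0 : h x0 = 0) (dh0 : forall l, 'D_(e l) h x0 = 0)
  (ddh0 : forall i l, 'D_(e i) (fun x => 'D_(e l) h x) x0 = kappa * (i == l)%:R).

Lemma is_derive_christoffel_diff k i j m :
  is_derive x0 (e m) (christoffel_diff k i j)
    (kappa * ((k == j)%:R * (m == i)%:R + (k == i)%:R * (m == j)%:R
              - invmx (G x0) k m * G x0 i j)).
Proof.
have dl l : is_derive x0 (e m) (fun x => 'D_(e l) h x) (kappa * (m == l)%:R).
  apply: DeriveDef; last exact: ddh0.
  apply: Ck_derivable Vx0; exact: (Ck_derive (e l) (Ch 2)).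
have dc l (c : R) : is_derive x0 (e m) (fun x => c * 'D_(e l) h x)
    (c * (kappa * (m == l)%:R)).
  exact: (@is_deriveZ _ _ _ _ c _ _ _ (dl l)).
have dG l : is_derive x0 (e m) (fun x => invmx (G x) k l * G x i j * 'D_(e l) h x)
    (invmx (G x0) k l * G x0 i j * (kappa * (m == l)%:R)).
  (* The value of [b] is irrelevant: the product rule multiplies it by the first derivative of [h],
     which vanishes at [x0]. *)
  have [b hb] : exists b, is_derive x0 (e m) (fun x => invmx (G x) k l * G x i j) b.
    eexists; apply/derivableP; apply: (@Ck_derivable _ _ 0 V) => //.
    by apply: Ck_mul => //; apply: Ck_invmx.
  have := is_deriveM hb (dl l).
  by rewrite dh0 scale0r addr0.
have dS : is_derive x0 (e m)
    (fun x => \sum_l invmx (G x) k l * G x i j * 'D_(e l) h x)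
    (\sum_l invmx (G x0) k l * G x0 i j * (kappa * (m == l)%:R)).
  by have := is_derive_sum dG; rewrite fct_sumE.
have dT := is_deriveD (dc i (k == j)%:R) (dc j (k == i)%:R).
apply: is_derive_eq (is_deriveB dT dS) _.
rewrite (bigD1 m)//= big1 => [|l lm]; last by rewrite eq_sym (negbTE lm) !mulr0.
by rewrite eqxx /=; ring.
Qed.

Lemma christoffel_conformal_center k i j :
  christoffel wG k i j x0 = christoffel G k i j x0.
Proof.
rewrite christoffel_conformal// /christoffel_diff !dh0 !mulr0.
rewrite big1 ?subr0 ?addr0// => l _.
by rewrite dh0 mulr0.
Qed.

Lemma pderiv_christoffel_conformal m k i j :
  pderiv m (christoffel wG k i j) x0 = pderiv m (christoffel G k i j) x0
  + kappa * ((k == j)%:R * (m == i)%:R + (k == i)%:R * (m == j)%:R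
             - invmx (G x0) k m * G x0 i j).
Proof.
rewrite !pderivE//.
have dC := is_derive_christoffel_diff k i j m.
rewrite (@near_eq_derive _ _ _ _ (christoffel G k i j \+ christoffel_diff k i j)).
  rewrite deriveD; last by case: dC.
    by case: dC => _ ->.
  apply: (@Ck_derivable _ _ 0 V) => //.
  by apply: Ck_christoffel => // a b.
near=> y; apply: christoffel_conformal; near: y; exact: open_nbhs_nbhs.
Unshelve. all: by end_near. Qed.

(** At [x0] the metric and the Christoffel symbols are unchanged, so the quadratic terms of the
    curvature agree and only the Hessian of [h] contributes. In dimension [n.+1] the Ricci
    components gain [kappa] times [(1 - n) delta_jk - tr(G^-1) G_jk]; contracting with [G^-1] gives
    [(1 - n) - (n + 1) = - 2 n] times the trace. *)
Lemma scalar_curv_conformal :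
  scalar_curv wG x0 = scalar_curv G x0 - 2 * n%:R * kappa * \tr (invmx (G x0)).
Proof.
have wG0 : wG x0 = G x0 by rewrite /wG /w h0 mulr0 expR0 scale1r.
have sum_delta (F : 'I_n.+1 -> R) j : \sum_i (i == j)%:R * F i = F j.
  rewrite (bigD1 j)//= eqxx mul1r big1 ?addr0// => i ij.
  by rewrite (negbTE ij) mul0r.
have ricciE j k : ricci wG j k x0 = ricci G j k x0
    + kappa * ((1 - n%:R) * (j == k)%:R - \tr (invmx (G x0)) * G x0 j k).
  rewrite /ricci.
  (* Summed over [i], the four Hessian terms give [delta_jk], [- tr(G^-1) G_jk],
     [- (n + 1) delta_jk] and [delta_jk]. *)
  transitivity (\sum_i (riemann G i k i j x0 + kappa *
      ((i == j)%:R * (i == k)%:R - invmx (G x0) i i * G x0 j k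
       - (j == k)%:R + invmx (G x0) j i * G x0 i k))).
    apply: eq_bigr => i _; rewrite /riemann !pderiv_christoffel_conformal.
    under eq_bigr do rewrite !christoffel_conformal_center.
    rewrite eqxx (eq_sym j i) /=.
    have -> : invmx (G x0) i j = invmx (G x0) j i.
      by have /matrixP/(_ j i) : (invmx (G x0))^T = invmx (G x0);
        [rewrite trmx_inv G_sym|rewrite mxE].
    by ring.
  rewrite big_split /= -mulr_sumr; congr (_ + _ * _).
  rewrite big_split /= !sumrB sum_delta.
  have -> : \sum_i invmx (G x0) j i * G x0 i k = (j == k)%:R.
    rewrite -(sum_invmx_mul j k Vx0); apply: eq_bigr => i _.
    by have /matrixP/(_ k i) := G_sym Vx0; rewrite mxE => ->.
  rewrite -mulr_suml -/(mxtrace _) sumr_const card_ord mulrS -mulr_natl.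
  by ring.
rewrite /scalar_curv wG0.
under eq_bigr do under eq_bigr do rewrite ricciE mulrDr.
under eq_bigr do rewrite big_split /=.
rewrite big_split /=; congr (_ + _).
transitivity (kappa * ((1 - n%:R) * \tr (invmx (G x0))
    - \tr (invmx (G x0)) * n.+1%:R)); last by rewrite mulrS; ring.
transitivity (\sum_j kappa * ((1 - n%:R) * invmx (G x0) j j
    - \tr (invmx (G x0)))).
  apply: eq_bigr => j _.
  transitivity (\sum_k (kappa * (1 - n%:R) * ((k == j)%:R * invmx (G x0) j k)
      - kappa * \tr (invmx (G x0)) * (invmx (G x0) j k * G x0 j k))).
    by apply: eq_bigr => k _; rewrite eq_sym; ring.
  rewrite sumrB -!mulr_sumr sum_delta sum_invmx_mul// eqxx /=; ring.
rewrite -mulr_sumr sumrB -mulr_sumr -/(mxtrace _) sumr_const card_ord -mulr_natl.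
by ring.
Qed.

End ConformalChange.

(** * The bump function and its derivatives at the centre *)

Section Bump.
Variables (R : realType) (n : nat) (a : 'rV[R]_n.+1) (r kappa : R).
Local Notation E := 'rV[R]_n.+1.
Local Notation e := (@basis_vec R n).
Hypothesis r0 : 0 < r.

Definition sqdist (y : E) : R := \sum_c (y ord0 c - a ord0 c) ^+ 2.

(* The constant makes the Hessian at [a] equal to [kappa] times the identity. *)
Definition bump (y : E) : R :=
  kappa / (2 * flat 1 r) * (sqdist y * flat 1 (r - sqdist y)).

Lemma flat_gt0 : 0 < flat 1 r.
Proof. by rewrite /flat r0 hornerC mul1r expR_gt0. Qed.

Lemma bump_center : bump a = 0.
Proof.
rewrite /bump /sqdist big1 ?mul0r ?mulr0// => c _.
by rewrite subrr expr0n.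
Qed.

Lemma bump_out y : r <= sqdist y -> bump y = 0.
Proof.
move=> ry; have -> // : bump y = kappa / (2 * flat 1 r) * (sqdist y * 0).
  by rewrite /bump /flat [0 < r - _]subr_gt0 [sqdist y < r]ltNge ry.
by rewrite !mulr0.
Qed.

Lemma Ck_sqdist k (V : set E) (T : E -> E) : open V ->
  (forall c, Ck k V (fun y => T y ord0 c)) -> Ck k V (fun y => sqdist (T y)).
Proof.
move=> oV CT; apply: Ck_sum => // c.
have Cd : Ck k V (fun y => T y ord0 c - a ord0 c).
  by apply: Ck_add => //; exact: Ck_cst.
exact: Ck_mul.
Qed.

(** [T] stands for the identity or for a smooth extension of a transition map, which gives
    smoothness of the bump as seen in another chart. *)
Lemma Ck_bump k (V : set E) (T : E -> E) : open V ->
  (forall c, Ck k V (fun y => T y ord0 c)) -> Ck k V (fun y => bump (T y)).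
Proof.
move=> oV CT; apply: Ck_mul => //; first exact: Ck_cst.
have Cs := Ck_sqdist oV CT.
apply: Ck_mul => //; apply: Ck_flat => //.
apply: (Ck_eq oV _ (Ck_add oV (@Ck_cst _ _ k V r)
  (Ck_mul oV (@Ck_cst _ _ k V (-1)) Cs))) => x _.
by rewrite mulN1r.
Qed.

(** The radial factor of the gradient: the i-th partial derivative of [bump] is [bump'] times
    [y_i - a_i]. *)
Let bump' (y : E) : R := kappa / flat 1 r *
  (flat 1 (r - sqdist y) - sqdist y * flat ('X^2 * (1 - 1^`())) (r - sqdist y)).

Lemma is_derive_coord_sub y c i :
  is_derive y (e i) (fun z : E => z ord0 c - a ord0 c) (c == i)%:R.
Proof.
have dcoord : is_derive y (e i) (fun z : E => z ord0 c) (c == i)%:R.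
  apply: DeriveDef; last by rewrite derive_coord mxE eqxx.
  by apply: diff_derivable; exact: differentiable_coord.
by have := is_deriveB dcoord (is_derive_cst (a ord0 c) y (e i)); rewrite subr0.
Qed.

Lemma is_derive_sqdist y i :
  is_derive y (e i) sqdist (2 * (y ord0 i - a ord0 i)).
Proof.
have dc c := is_derive_coord_sub y c i.
have := is_derive_sum (fun c => is_deriveM (dc c) (dc c)).
rewrite fct_sumE => H; apply: is_derive_eq H _.
rewrite (bigD1 i)//= big1 => [|c /negbTE ->]; last by rewrite !scaler0 addr0.
by rewrite eqxx /GRing.scale /=; ring.
Qed.

Lemma derive_bump i :
  (fun y => 'D_(e i) bump y) = (fun y => bump' y * (y ord0 i - a ord0 i)).
Proof.
apply/funext => y.
have dq := is_derive_sqdist y i.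
have dfq : differentiable sqdist y.
  apply: (@Ck_differentiable _ _ 0 setT) => //.
  by apply: (@Ck_sqdist _ _ id) => [|c]; [exact: openT|apply: Ck_coord; exact: openT].
have dr : is_derive y (e i) (fun z => r - sqdist z) (- (2 * (y ord0 i - a ord0 i))).
  have := is_deriveB (is_derive_cst r y (e i)) dq; by rewrite sub0r.
have dfr : differentiable (fun z => r - sqdist z) y.
  by apply: differentiableB => //; exact: differentiable_cst.
have [fd fD] := derive_comp_real (e i) (is_derive_flat 1 (r - sqdist y)) dfr.
have dfl : is_derive y (e i) (fun z => flat 1 (r - sqdist z))
   (flat ('X^2 * (1 - 1^`())) (r - sqdist y) * - (2 * (y ord0 i - a ord0 i))).
  apply: DeriveDef; first exact: diff_derivable.
  by rewrite fD; congr (_ * _); case: dr.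
have := is_deriveZ (kappa / (2 * flat 1 r)) (is_deriveM dq dfl) => -[_ H].
rewrite -[bump]/(kappa / (2 * flat 1 r) *:
  (sqdist * (fun z => flat 1 (r - sqdist z)))) H.
rewrite /bump' /GRing.scale /=.
have f0 : flat 1 r != 0 by rewrite gt_eqF// flat_gt0.
by field.
Qed.

Lemma derive_bump_center i : 'D_(e i) bump a = 0.
Proof.
by have /(congr1 (@^~ a)) /= -> := derive_bump i; rewrite subrr mulr0.
Qed.

(** In the product rule for [bump' y * (y_i - a_i)] the derivative of [bump'] is multiplied by zero
    at [a], and [bump' a = kappa] because the squared distance vanishes there. *)
Lemma derive2_bump_center m i :
  'D_(e m) (fun y => 'D_(e i) bump y) a = kappa * (m == i)%:R.
Proof.
have oT : open [set: E] by exact: openT.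
have Cq k : Ck k setT sqdist.
  by apply: (@Ck_sqdist k _ id) => // c; exact: Ck_coord.
have Cf p : Ck 1 setT (fun y => flat p (r - sqdist y)).
  apply: Ck_flat => //.
  apply: (Ck_eq oT _ (Ck_add oT (@Ck_cst _ _ 1 setT r)
    (Ck_mul oT (@Ck_cst _ _ 1 setT (-1)) (Cq 1)))) => x _.
  by rewrite mulN1r.
have Cb : Ck 1 setT bump'.
  apply: Ck_mul => //; first exact: Ck_cst.
  apply: (Ck_eq oT _ (Ck_add oT (Cf 1) (Ck_mul oT (@Ck_cst _ _ 1 setT (-1))
    (Ck_mul oT (Cq 1) (Cf ('X^2 * (1 - 1^`()))))))) => x _.
  by rewrite mulN1r.
have db : derivable bump' a (e m) by exact: (@Ck_derivable _ _ 0 setT).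
have f0 : flat 1 r != 0 by rewrite gt_eqF// flat_gt0.
have dc := is_derive_coord_sub a i m; rewrite eq_sym in dc.
have [_] := is_deriveM (derivableP db) dc.
rewrite derive_bump => ->; rewrite subrr scale0r addr0 /GRing.scale /=.
have -> : bump' a = kappa; last by [].
rewrite /bump' {2}/sqdist [X in _ - X * _]big1 => [|c _]; last first.
  by rewrite subrr expr0n.
rewrite /sqdist big1 => [|c _]; last by rewrite subrr expr0n.
by rewrite mul0r !subr0; field.
Qed.

End Bump.

(** * Locality of the curvatures, and operations on [smooth_on] functions *)

Section Locality.
Variables (R : realType) (n : nat).
Local Notation E := 'rV[R]_n.+1.
Implicit Types (A : set E) (f g : E -> R).

(** Equality of germs relative to the half-space, which is all that chart expressions of a metric
    determine at a boundary point. *)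
Definition near_half (T : Type) (f g : E -> T) (x : E) : Prop :=
  \forall y \near x, halfspace y -> f y = g y.

(** Agreement near [x] is agreement near every point close to [x]. Locality of a first-order
    expression thus passes to its derivatives, as curvature requires. *)
Lemma near_halfS (T U : Type) (f g : E -> T) (F G : E -> U) x :
  (forall y, halfspace y -> near_half f g y -> F y = G y) ->
  near_half f g x -> near_half F G x.
Proof.
move=> FG fg; have {fg} := near_join fg.
by apply: filterS => y fgy hy; exact: FG.
Qed.

Lemma near_half_map (T U : Type) (f g : E -> T) (op : T -> U) x :
  near_half f g x -> near_half (fun y => op (f y)) (fun y => op (g y)) x.
Proof. by apply: filterS => y fg hy; rewrite fg. Qed.

Lemma near_half_id (T : Type) (f g : E -> T) x :
  halfspace x -> near_half f g x -> f x = g x.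
Proof. by move=> hx fg; exact: nbhs_singleton fg hx. Qed.

Section Metric.
Variables (G G' : E -> 'M[R]_n.+1).

Lemma christoffel_local k i j x : halfspace x -> near_half G G' x ->
  christoffel G k i j x = christoffel G' k i j x.
Proof.
move=> hx GG; rewrite /christoffel (near_half_id hx GG); congr (_ * _).
apply: eq_bigr => l _.
have D a b c : pderiv a (fun y => G y b c) x = pderiv a (fun y => G' y b c) x.
  apply: pderiv_near => //.
  exact: (near_half_map (fun B : 'M[R]_n.+1 => B b c) GG).
by rewrite !D.
Qed.

Lemma riemann_local l k i j x : halfspace x -> near_half G G' x ->
  riemann G l k i j x = riemann G' l k i j x.
Proof.
move=> hx GG; rewrite /riemann.
have D a b c d : pderiv a (christoffel G b c d) x = pderiv a (christoffel G' b c d) x.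
  apply: pderiv_near => //; apply: near_halfS GG => y.
  exact: christoffel_local.
rewrite !D; congr (_ + _); apply: eq_bigr => m _.
by rewrite !(christoffel_local _ _ _ hx GG).
Qed.

Lemma scalar_curv_local x : halfspace x -> near_half G G' x ->
  scalar_curv G x = scalar_curv G' x.
Proof.
move=> hx GG; rewrite /scalar_curv /ricci (near_half_id hx GG).
apply: eq_bigr => j _; apply: eq_bigr => k _; congr (_ * _).
by apply: eq_bigr => i _; exact: riemann_local.
Qed.

Lemma mean_curv_local x : halfspace x -> near_half G G' x ->
  mean_curv G x = mean_curv G' x.
Proof.
move=> hx GG; rewrite /mean_curv /induced_metric (near_half_id hx GG).
congr (_ * \tr (_ *m _)); apply/matrixP => a b; rewrite !mxE.
apply: eq_bigr => k _; rewrite (near_half_id hx GG); congr (_ * _).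
rewrite /nabla_normal; congr (_ + _).
  apply: pderiv_near => //.
  exact: (near_half_map (fun B : 'M[R]_n.+1 =>
    - (invmx B k ord0 / Num.sqrt (invmx B ord0 ord0))) GG).
apply: eq_bigr => l _; rewrite (christoffel_local _ _ _ hx GG) /unit_normal.
by rewrite (near_half_id hx GG).
Qed.

End Metric.

Lemma smooth_on_mul A f g :
  smooth_on A f -> smooth_on A g -> smooth_on A (fun x => f x * g x).
Proof.
move=> sf sg x Ax; have [V [F [oV Vx CF Ff]]] := sf _ Ax.
have [W [H [oW Wx CH Hg]]] := sg _ Ax.
have oVW : open (V `&` W) by exact: openI.
exists (V `&` W), (fun x => F x * H x); split => // [k|y [Vy Wy] Ay].
  apply: Ck_mul => //; [apply: Ck_sub (CF k)|apply: Ck_sub (CH k)];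
  by [apply: subIsetl|apply: subIsetr].
by rewrite Ff ?Hg.
Qed.

Lemma smooth_on_expR A f (c : R) :
  smooth_on A f -> smooth_on A (fun x => expR (c * f x)).
Proof.
move=> sf x Ax; have [V [F [oV Vx CF Ff]]] := sf _ Ax.
exists V, (fun x => expR (c * F x)); split => // [k|y Vy Ay].
  by apply: Ck_expR => //; apply: Ck_mul => //; exact: Ck_cst.
by rewrite Ff.
Qed.

Lemma smooth_on_ext A f g : (forall x, A x -> f x = g x) ->
  smooth_on A f -> smooth_on A g.
Proof.
move=> fg sf x Ax; have [V [F [oV Vx CF Ff]]] := sf _ Ax.
by exists V, F; split => // y Vy Ay; rewrite Ff ?fg.
Qed.

Lemma smooth_on_family (I : finType) A (f : I -> E -> R) x :
  (forall i, smooth_on A (f i)) -> A x ->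
  exists (V : set E) (F : I -> E -> R),
    [/\ open V, V x, (forall i k, Ck k V (F i)) &
        forall i y, V y -> A y -> F i y = f i y].
Proof.
move=> sf Ax.
have /choice [VF H] i : exists VF : set E * (E -> R),
    [/\ open VF.1, VF.1 x, (forall k, Ck k VF.1 VF.2) &
        forall y, VF.1 y -> A y -> VF.2 y = f i y].
  by have [V [F HF]] := sf i _ Ax; exists (V, F).
(* The interior of the intersection of all the domains; it contains [x] because the index type is
   finite. *)
exists [set y | \forall z \near y, forall i, (VF i).1 z], (fun i => (VF i).2).
have sub i : [set y | \forall z \near y, forall i, (VF i).1 z] `<=` (VF i).1.
  by move=> y /= /nbhs_singleton.
split.
- exact: open_interior.
- suff : \forall z \near x, forall i, (VF i).1 z by [].
  apply: (@filter_forall _ _ (fun i => (VF i).1) (nbhs x)) => i.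
  by have [oV Vx _ _] := H i; exact: open_nbhs_nbhs.
- by move=> i k; apply: Ck_sub (sub i) _; have [_ _] := H i.
- by move=> i y /sub Vy; have [_ _ _] := H i; apply.
Qed.

(** Inside [A] the local extensions coincide with the functions themselves, so the functions are
    genuinely of class C^k on a common neighbourhood. *)
Lemma smooth_on_interior (I : finType) A (f : I -> E -> R) x :
  (forall i, smooth_on A (f i)) -> nbhs x A ->
  exists V : set E,
    [/\ open V, V x, V `<=` A & forall i k, Ck k V (f i)].
Proof.
move=> sf nA; have Ax := nbhs_singleton nA.
have [V [F [oV Vx CF Ff]]] := smooth_on_family sf Ax.
have oVA : open (V `&` A°) by apply: openI => //; exact: open_interior.
have sA : V `&` A° `<=` A by move=> y [_ /interior_subset].
exists (V `&` A°); split => // i k.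
apply: (@Ck_eq _ _ _ _ (F i)) => //; last first.
  by apply: Ck_sub (CF i k); exact: subIsetl.
by move=> y [Vy iA]; apply: Ff => //; exact: interior_subset.
Qed.

End Locality.

(** * Positive definite matrices *)

Section PositiveDefinite.
Variables (R : realType) (n : nat) (G : 'M[R]_n.+1).
Hypothesis G_pos : forall v : 'rV[R]_n.+1, v != 0 -> 0 < (v *m G *m v^T) ord0 ord0.

Lemma posdef_unit : G \in unitmx.
Proof.
rewrite unitmxE unitfE; apply/negP => /det0P [v v0 vG].
by have := G_pos v0; rewrite vG mul0mx mxE ltxx.
Qed.

(** Evaluating the quadratic form of [G] on the i-th row of [invmx G] returns the i-th diagonal
    entry of [invmx G], which is therefore positive. *)
Lemma posdef_trace_inv : G^T = G -> 0 < \tr (invmx G).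
Proof.
move=> G_sym.
have pos i : 0 < invmx G i i.
  have v0 : row i (invmx G) != 0.
    apply/eqP => /(congr1 (mulmx^~ G)); rewrite -row_mul mulVmx ?posdef_unit//.
    rewrite mul0mx => /rowP /(_ i) /eqP; rewrite !mxE eqxx.
    by rewrite oner_eq0.
  have := G_pos v0; rewrite -row_mul mulVmx ?posdef_unit// tr_row trmx_inv G_sym.
  have -> // : (row i 1%:M *m col i (invmx G)) ord0 ord0 = invmx G i i.
  rewrite row1 mxE (bigD1 i)//= big1 => [|k /negbTE ki]; last first.
    by rewrite !mxE ki andbF mul0r.
  by rewrite !mxE !eqxx mul1r addr0.
rewrite /mxtrace big_ord_recl ltr_pwDl//; apply: sumr_ge0 => i _; exact: ltW.
Qed.

End PositiveDefinite.

(** * First-order condition at a local minimum *)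

Section LocalMinimum.
Variables (R : realType) (n : nat).
Local Notation E := 'rV[R]_n.+1.

(** Right-hand difference quotients at a minimum are nonnegative in every direction; the directions
    [v] and [- v] together force zero. *)
Lemma derive_min0 (f : E -> R) x v : differentiable f x ->
  (\forall y \near x, f x <= f y) -> 'D_v f x = 0.
Proof.
move=> df fmin.
have ge0 u : 0 <= 'D_u f x.
  have cx : (h *: u + x) @[h --> (0 : R)] --> x.
    rewrite -[X in _ --> X]add0r -(scale0r u).
    by apply: cvgD; [apply: cvgZr_tmp; exact: cvg_id|exact: cvg_cst].
  have du : derivable f x u by exact: diff_derivable.
  rewrite /derive cvg_at_rightE//; apply: limr_ge.
    rewrite -(cvg_at_rightE (fun h : R => h^-1 *: ((f \o shift x) (h *: u) - f x)))//.
    apply: cvg_trans du; apply: cvg_app => A [d d0 Ad].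
    by exists d => // h hd h0; apply: Ad => //; exact/lt0r_neq0.
  near=> h; apply: mulr_ge0.
    by rewrite invr_ge0 ltW//; near: h; exact: nbhs_right_gt.
  rewrite subr_ge0 /=; near: h; apply: cvg_within; exact: cx fmin.
apply/eqP; rewrite eq_le ge0 andbT -oppr_ge0.
by have := ge0 (- v); rewrite !deriveE// linearN.
Unshelve. all: by end_near. Qed.

End LocalMinimum.

(** * Charts, overlaps and invariance of the interior *)

Section ManifoldTopology.
Variables (R : realType) (n : nat) (M : bmanifold R n).
Local Notation E := 'rV[R]_n.+1.
Implicit Types (i j : chart_idx M) (x : E) (q : M).

Lemma cimg_halfspace i x : cimg i x -> halfspace x.
Proof. by rewrite /cimg; have [V [_ ->]] := cmap_open i; case. Qed.

Lemma cinv_cdom i x : cimg i x -> cdom i (cinv i x).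
Proof. by move=> [q iq <-]; rewrite cmapK. Qed.

Lemma cinvK i x : cimg i x -> cmap i (cinv i x) = x.
Proof. by move=> [q iq <-]; rewrite cmapK. Qed.

Lemma near_cimg i x : cimg i x -> \forall y \near x, halfspace y -> cimg i y.
Proof.
rewrite /cimg; have [V [oV ->]] := cmap_open i => -[Vx _].
by apply: filterS (open_nbhs_nbhs (conj oV Vx)) => y Vy hy.
Qed.

Lemma near_cinv i x (U : set M) : cimg i x -> open U -> U (cinv i x) ->
  \forall y \near x, cimg i y -> U (cinv i y).
Proof.
move=> ix oU Ux; have /subspace_continuousP/(_ _ ix) := @cinv_continuous _ _ M i.
by apply; exact: open_nbhs_nbhs.
Qed.

Lemma halfspace_nbhs x : 0 < x ord0 ord0 -> \forall y \near x, 0 < (y : E) ord0 ord0.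
Proof.
move=> x0; have c : {for x, continuous (fun y : E => y ord0 ord0)}.
  exact: coord_continuous.
exact: (c [set t | 0 < t] (lt_nbhsr x0)).
Qed.

Lemma interior_cimg i x : cimg i x -> 0 < x ord0 ord0 -> nbhs x (cimg i).
Proof.
move=> ix x0; apply: filterS2 (near_cimg ix) (halfspace_nbhs x0) => y + y0.
by apply; exact: ltW.
Qed.

Lemma near_overlap i j x : cimg i x -> cdom j (cinv i x) ->
  \forall y \near x, cimg i y -> (cmap i @` (cdom i `&` cdom j)) y.
Proof.
move=> ix jx; apply: filterS (near_cinv ix (cdom_open j) jx) => y jy iy.
by exists (cinv i y); [split; [exact: cinv_cdom|exact: jy]|exact: cinvK].
Qed.

(* A metric makes the transition Jacobians invertible, whereas the component
   [x_0] of a transition sending an interior point to the boundary would have a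
   minimum, hence a vanishing differential, there. *)
Lemma interior_chart (g : riemannian_metric M) i j q : cdom i q -> cdom j q ->
  0 < cmap i q ord0 ord0 -> 0 < cmap j q ord0 ord0.
Proof.
move=> iq jq x0; set x := cmap i q in x0.
have ix : cimg i x by exists q.
have jjq : cimg j (cmap j q) by exists q.
have xq : cinv i x = q by exact: cmapK.
have le0 : 0 <= cmap j q ord0 ord0 := cimg_halfspace jjq.
rewrite lt_neqAle le0 andbT eq_sym; apply/eqP => q0.
have Ax : (cmap i @` (cdom i `&` cdom j)) x by exists q.
have nA : nbhs x (cmap i @` (cdom i `&` cdom j)).
  have jx : cdom j (cinv i x) by rewrite xq.
  by apply: filterS2 (near_overlap ix jx) (interior_cimg ix x0) => y; apply.
pose f y := cmap j (cinv i y) ord0 ord0.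
have df : differentiable f x.
  have [V [_ Vx _ Cf]] := @smooth_on_interior R n unit _ (fun=> f) x
    (fun=> @transition_smooth _ _ M i j ord0) nA.
  exact: Ck_differentiable (Cf tt 1) Vx.
have fmin : \forall y \near x, f x <= f y.
  apply: filterS nA => y [q' [iq' jq'] <-]; rewrite /f xq q0 cmapK//.
  by apply: (@cimg_halfspace j); exists q'.
have J0 a : transition_jac i j x a ord0 = 0.
  by rewrite mxE pderiv_interior// derive_min0.
have /det0P [v v0 vJ] : \det (transition_jac i j x) == 0.
  rewrite -det_tr; apply/det0P; exists (delta_mx ord0 ord0).
    by apply/eqP => /matrixP/(_ ord0 ord0)/eqP; rewrite !mxE oner_eq0.
  by apply/rowP => a; have := J0 a; rewrite -rowE !mxE.
by have := gmx_pos g ix v0; rewrite (gmx_compat g Ax) !mulmxA vJ !mul0mx mxE ltxx.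
Qed.

End ManifoldTopology.

(** * The bump transplanted to the manifold *)

Section LogFactor.
Variables (R : realType) (n : nat) (M : bmanifold R n) (j : chart_idx M).
Local Notation E := 'rV[R]_n.+1.
Variables (a : E) (r kappa : R).
Hypotheses (r0 : 0 < r)
  (rball : forall y, sqdist a y <= r -> cimg j y /\ 0 < y ord0 ord0).

Definition log_factor (q : M) : R :=
  if `[< cdom j q >] then bump a r kappa (cmap j q) else 0.

Let K : set M := cinv j @` [set y | sqdist a y <= r].

Lemma sqdist_le_coord y c : sqdist a y <= r -> (y ord0 c - a ord0 c) ^+ 2 <= r.
Proof.
apply: le_trans; rewrite /sqdist (bigD1 c)//= lerDl.
by apply: sumr_ge0 => k _; exact: sqr_ge0.
Qed.

Lemma compact_sqdist_ball : compact [set y | sqdist a y <= r].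
Proof.
have clB : closed [set y | sqdist a y <= r].
  have c : continuous (sqdist a).
    have oT : open [set: E] by exact: openT.
    by move=> y; apply: (@Ck_sqdist _ _ a 0 setT id) => // k; exact: Ck_coord.
  exact: (closed_comp (fun y _ => c y) (@closed_le _ r)).
(* A box of half-width [1 + r] needs no square root: [(d + 1)^2 >= 0] and [(d - 1)^2 >= 0] bound
   [2 |d|] by [d^2 + 1], hence by [r + 1]. *)
have cB := @rV_compact R n.+1
  (fun c => `[a ord0 c - (1 + r), a ord0 c + (1 + r)]%classic)
  (fun c => @segment_compact _ _ _).
apply: (subclosed_compact clB cB) => y /= /sqdist_le_coord Hy c.
have := Hy c; rewrite in_itv /=; set d := y ord0 c - _ => h.
have := sqr_ge0 (d - 1); have := sqr_ge0 (d + 1); rewrite sqrrD1 sqrrB1 => h1 h2.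
have -> : y ord0 c = a ord0 c + d by rewrite addrC subrK.
by apply/andP; split; lra.
Qed.

(** The continuous image of a compact ball is closed in a Hausdorff space. This makes the extension
    by zero vanish near every point outside the domain of chart [j]. *)
Lemma log_support_closed : closed K.
Proof.
apply: compact_closed; first exact: bm_hausdorff.
apply: continuous_compact; last exact: compact_sqdist_ball.
apply: continuous_subspaceW (@cinv_continuous _ _ M j) => y /= /rball[jy _].
exact: jy.
Qed.

Lemma log_factor_out q : ~ K q -> log_factor q = 0.
Proof.
move=> Kq; rewrite /log_factor; case: asboolP => // jq.
apply: bump_out => //; rewrite leNgt; apply/negP => /ltW h.
by apply: Kq; exists (cmap j q) => //; exact: cmapK.
Qed.

(** Off the domain of chart [j] the function vanishes locally, the support being closed; on it, the
    bump is composed with local extensions of the components of the transition map. *)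
Lemma log_factor_smooth : smooth_fun log_factor.
Proof.
move=> i x ix.
have [jx|jx] := pselect (cdom j (cinv i x)); last first.
  have Kx : ~ K (cinv i x).
    by move=> [y /rball[jy _] yx]; apply: jx; rewrite -yx; exact: cinv_cdom.
  have oK : open (~` K) by rewrite openC; exact: log_support_closed.
  exists [set y | \forall z \near y, cimg i z -> (~` K) (cinv i z)], (cst 0).
  split=> [||k|y /nbhs_singleton yK /yK].
  - exact: open_interior.
  - exact: near_cinv ix oK Kx.
  - exact: Ck_cst.
  - by move=> iy; rewrite /= log_factor_out//.
have Ax : (cmap i @` (cdom i `&` cdom j)) x.
  by exists (cinv i x); [split=> //; exact: cinv_cdom|exact: cinvK].
have [V [F [oV Vx CF Ff]]] :=
  smooth_on_family (fun k => @transition_smooth _ _ M i j k) Ax.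
have near_j := near_overlap ix jx.
pose W : set E := [set y | \forall z \near y, cimg i z ->
  (cmap i @` (cdom i `&` cdom j)) z].
have oW : open W by exact: open_interior.
have oVW : open (V `&` W) by exact: openI.
exists (V `&` W), (fun y => bump a r kappa (\row_k F k y)); split=> //.
  move=> k; apply: Ck_bump => // c.
  apply: (Ck_eq oVW _ (Ck_sub (@subIsetl _ V W) (CF c k))) => y _.
  by rewrite mxE.
move=> y [Vy /nbhs_singleton Wy] iy.
have Ay := Wy iy; have [q [iq jq] qy] := Ay.
rewrite /log_factor /=; have -> : cinv i y = q by rewrite -qy cmapK.
rewrite asboolT//; congr bump; apply/rowP => c.
by rewrite mxE Ff// -qy cmapK.
Qed.

Lemma log_factor_chart y : cimg j y -> log_factor (cinv j y) = bump a r kappa y.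
Proof.
by move=> jy; rewrite /log_factor asboolT ?cinvK//; exact: cinv_cdom.
Qed.

(** A point of the support has positive first coordinate in chart [j], hence in every chart by
    [interior_chart]. A boundary point therefore lies in the open complement of the support. *)
Lemma log_factor_near_boundary (g : riemannian_metric M) i q : cdom i q ->
  cmap i q ord0 ord0 = 0 ->
  \forall y \near cmap i q, cimg i y -> log_factor (cinv i y) = 0.
Proof.
move=> iq q0.
have Kq : ~ K q.
  move=> [y /rball[jy y0] yq]; have jq : cdom j q by rewrite -yq; exact: cinv_cdom.
  have : 0 < cmap j q ord0 ord0 by rewrite -yq cinvK.
  by move=> /(interior_chart g jq iq); rewrite q0 ltxx.
have oK : open (~` K) by rewrite openC; exact: log_support_closed.
have iq' : cimg i (cmap i q) by exists q.
have Kq' : (~` K) (cinv i (cmap i q)) by rewrite cmapK.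
apply: filterS (near_cinv iq' oK Kq') => y + iy => /(_ iy).
exact: log_factor_out.
Qed.

End LogFactor.

(** * The metric [e^(2f) g] *)

Section ConformalMetric.
Variables (R : realType) (n : nat) (M : bmanifold R n).
Variables (g : riemannian_metric M) (f : M -> R).
Hypothesis f_smooth : smooth_fun f.

Let G' (i : chart_idx M) x : 'M[R]_n.+1 := expR (2 * f (cinv i x)) *: gmx g i x.

Lemma conf_smooth i a b : smooth_on (cimg i) (fun x => G' i x a b).
Proof.
have := smooth_on_mul (smooth_on_expR 2 (@f_smooth i)) (@gmx_smooth _ _ _ g i a b).
by apply: smooth_on_ext => x _; rewrite !mxE.
Qed.

Lemma conf_sym i x : cimg i x -> (G' i x)^T = G' i x.
Proof. by move=> ix; rewrite linearZ /= gmx_sym. Qed.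

Lemma conf_pos i x (v : 'rV[R]_n.+1) : cimg i x -> v != 0 ->
  0 < (v *m G' i x *m v^T) ord0 ord0.
Proof.
move=> ix v0; rewrite -scalemxAr -scalemxAl mxE mulr_gt0 ?expR_gt0//.
exact: gmx_pos.
Qed.

Lemma conf_compat i j x : (cmap i @` (cdom i `&` cdom j)) x ->
  G' i x = transition_jac i j x *m G' j (cmap j (cinv i x))
             *m (transition_jac i j x)^T.
Proof.
move=> Ax; have [q [iq jq] qx] := Ax.
rewrite /G' -scalemxAr -scalemxAl -gmx_compat//; congr (expR (2 * f _) *: _).
by rewrite -qx !cmapK.
Qed.

Definition conformal_metric : riemannian_metric M :=
  RiemannianMetric conf_smooth conf_sym conf_pos conf_compat.

Lemma conformal_metricP : (3 <= n.+1)%N -> conformal g conformal_metric.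
Proof.
move=> n3; pose c : R := crit_exp R n - 2.
have c0 : c != 0.
  have n2 : (2 : R) < n.+1%:R by rewrite ltr_nat.
  have d0 : n.+1%:R - 2 != 0 :> R by rewrite subr_eq0 gt_eqF.
  (* With d the dimension, p - 2 = 4 / (d - 2), where d > 2. *)
  have -> : c = 4 / (n.+1%:R - 2) 
    by rewrite /c /crit_exp; move: d0; move: (n.+1%:R : R) => m d0; field.
  by rewrite mulf_neq0 ?invr_eq0// pnatr_eq0.
(* The exponent [2 / c] makes the [c]-th power of this factor equal to [e^(2f)]. *)
exists (fun q => expR (2 / c * f q)); split.
- by move=> i; exact: (smooth_on_expR (2 / c) (@f_smooth i)).
- by move=> q; exact: expR_gt0.
- move=> i x ix; rewrite -expRM /= /G'; congr (expR _ *: _).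
  by rewrite -/c mulrAC divfK.
Qed.

End ConformalMetric.

(** * Interior points and coordinate balls *)

Section InteriorPoints.
Variables (R : realType) (n : nat).
Local Notation E := 'rV[R]_n.+1.

Lemma halfspace_interior_point (x : E) (P : set E) : halfspace x -> nbhs x P ->
  exists2 y, P y & 0 < y ord0 ord0.
Proof.
move=> hx /nbhs_ballP [d d0 dP]; have {}d0 : 0 < d := d0.
exists (x + (d / 2) *: basis_vec R ord0); last first.
  by rewrite coord_basis_vec eqxx mulr1 ltr_wpDl// divr_gt0.
apply: dP; split => // i c; rewrite [i]ord1 coord_basis_vec /ball /=.
rewrite opprD addrA subrr sub0r normrN.
by case: (c == ord0) => /=; rewrite ?mulr1 ?mulr0 ?normr0// gtr0_norm; lra.
Qed.

Lemma sqdist_ball_sub (x : E) (P : set E) : nbhs x P ->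
  exists2 r, 0 < r & forall y, sqdist x y <= r -> P y.
Proof.
move=> /nbhs_ballP [d d0 dP]; have {}d0 : 0 < d := d0.
(* The norm is the sup norm: squared distance at most [(d / 2)^2] keeps each coordinate within
   [d / 2], strictly below [d]. *)
exists ((d / 2) ^+ 2); first by rewrite exprn_gt0// divr_gt0.
move=> y xy; apply: dP; split=> // i c; rewrite [i]ord1 /ball /= distrC.
have h := sqdist_le_coord c xy.
by rewrite ltr_norml; apply/andP; split; nra.
Qed.

Lemma open_halfspace_gt : open [set y : E | 0 < y ord0 ord0].
Proof.
apply: (@open_comp _ _ (fun y : E => y ord0 ord0) [set t | 0 < t]).
  by move=> y _; exact: coord_continuous.
exact: open_gt.
Qed.

End InteriorPoints.

(** * Curvature of the perturbed metric, and the conclusion *)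

Lemma scalar_curv_bump_factor (R : realType) (n : nat) (M : bmanifold R n)
    (g : riemannian_metric M) (j : chart_idx M) (a : 'rV[R]_n.+1) (r kappa : R)
    (r0 : 0 < r)
    (rball : forall y, sqdist a y <= r -> cimg j y /\ 0 < y ord0 ord0) :
  scalar_curv (gmx (conformal_metric g (log_factor_smooth kappa rball)) j) a =
  scalar_curv (gmx g j) a - 2 * n%:R * kappa * \tr (invmx (gmx g j a)).
Proof.
have [ja a0] : cimg j a /\ 0 < a ord0 ord0.
  by apply: rball; rewrite /sqdist big1 ?ltW// => c _; rewrite subrr expr0n.
(* Indexing by pairs yields one neighbourhood on which all metric components are smooth. *)
have [U [oU Ua Usub CU]] := @smooth_on_interior R n ('I_n.+1 * 'I_n.+1)%type _
  (fun ab x => gmx g j x ab.1 ab.2) a (fun ab => @gmx_smooth _ _ _ g j ab.1 ab.2)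
  (interior_cimg ja a0).
pose V := U `&` [set y | 0 < y ord0 ord0].
have oV : open V by apply: openI => //; exact: open_halfspace_gt.
have V_gt0 y : V y -> 0 < y ord0 ord0 by case.
have VU : V `<=` U by exact: subIsetl.
(* The conformal factor equals the explicit bump only on the image of chart [j]; locality permits
   the replacement. *)
rewrite (@scalar_curv_local _ _ _
  (fun y => expR (2 * bump a r kappa y) *: gmx g j y)); first last.
- apply: filterS (near_cimg ja) => y + hy => /(_ hy) jy /=.
  by rewrite log_factor_chart.
- exact: ltW.
apply: (@scalar_curv_conformal R n V oV V_gt0 (gmx g j) (bump a r kappa)).
- by move=> k c d; apply: Ck_sub VU _; exact: CU (c, d) k.
- by move=> y [/Usub jy _]; exact: gmx_sym.
- by move=> y [/Usub jy _]; apply: posdef_unit => v; exact: gmx_pos.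
- by move=> k; apply: (@Ck_bump _ _ _ _ _ k V id) => // c; exact: Ck_coord.
- by split.
- exact: bump_center.
- by move=> l; exact: derive_bump_center.
- by move=> i l; exact: derive2_bump_center.
Qed.

Theorem theorem5p7 (R : realType) (n : nat) (hn : (3 <= n.+1)%N)
  (M : bmanifold R n) (Mcompact : compact [set: M]) (Mnonempty : [set: M] !=set0)
  (g : riemannian_metric M)
  (Sg_ge0 : forall p : M, 0 <= scalar_curvature g p) :
  exists g' : riemannian_metric M,
    [/\ conformal g g',
        (exists p : M, scalar_curvature g' p < 0) &
        forall p : M, bm_boundary p ->
          Num.sg (mean_curvature g p) = Num.sg (mean_curvature g' p)].
Proof.
have [q _] := Mnonempty.
(* An arbitrary point is pushed off the boundary inside its chart. The chart chosen at the new point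
   may be another one, whence [interior_chart]. *)
have [p p0] : exists p : M, 0 < cmap (chart_at p) p ord0 ord0.
  set i := chart_at q.
  have iq : cimg i (cmap i q) by exists q => //; exact: chart_atP.
  have [y iy y0] := halfspace_interior_point (cimg_halfspace iq) (near_cimg iq).
  have {}iy : cimg i y by apply: iy; exact: ltW.
  exists (cinv i y); apply: (@interior_chart _ _ M g i); last by rewrite cinvK.
    exact: cinv_cdom.
  exact: chart_atP.
set j := chart_at p in p0; set a := cmap j p in p0.
have ja : cimg j a by exists p => //; exact: chart_atP.
have [r r0 rball] : exists2 r, 0 < r &
    forall y, sqdist a y <= r -> cimg j y /\ 0 < y ord0 ord0.
  apply: (@sqdist_ball_sub _ _ a (fun y => cimg j y /\ 0 < y ord0 ord0)).
  by apply: filterS2 (interior_cimg ja p0) (halfspace_nbhs p0) => y.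
pose t := \tr (invmx (gmx g j a)).
have t0 : 0 < t.
  by apply: posdef_trace_inv => [v|]; [exact: gmx_pos|exact: gmx_sym].
have n0 : 0 < n%:R :> R by rewrite ltr0n; case: (n) hn.
(* Chosen so that the new scalar curvature at [p] is S - (S + 1) = -1. *)
pose kappa := (scalar_curvature g p + 1) / (2 * n%:R * t).
exists (conformal_metric g (log_factor_smooth kappa rball)); split.
- exact: conformal_metricP.
- exists p; rewrite /scalar_curvature scalar_curv_bump_factor// -/j -/a -/t.
  rewrite -/(scalar_curvature g p) /kappa.
  have -> : scalar_curvature g p
      - 2 * n%:R * ((scalar_curvature g p + 1) / (2 * n%:R * t)) * t = -1.
    by field; rewrite !gt_eqF.
  by rewrite ltrN10.
(* The two metrics coincide near every boundary point, so the mean curvatures themselves are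
   equal. *)
- move=> s s0; congr Num.sg; apply: mean_curv_local.
    by apply: (@cimg_halfspace _ _ _ (chart_at s)); exists s => //; exact: chart_atP.
  have si : cimg (chart_at s) (cmap (chart_at s) s).
    by exists s => //; exact: chart_atP.
  apply: filterS2 (near_cimg si)
    (log_factor_near_boundary kappa rball g (chart_atP s) s0) => y + + hy.
  move=> /(_ hy) iy /(_ iy) fy.
  by rewrite /= fy mulr0 expR0 scale1r.
Qed.
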